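(* Let $\alpha\in(-1,1)$. Consider, for a parameter $\eta>0$, the problem $u_{tt}-u_{xx}=\eta\,\delta(x-\alpha)\,u$ for $x\in(-1,1)$, $t>0$, with boundary conditions $u(-1,t)=0$ and $u_t(1,t)+u_x(1,t)=0$ for $t>0$. Then there is a unique value $\eta=\eta^c$ of the parameter for which this problem admits a (not identically zero) steady-state solution, and it is given by $$\eta^c=\frac{1}{1+\alpha}.$$
   Context: Here $\delta$ is the Dirac $\delta$-function, and $u$ is real-valued. Solutions are continuous in $x$ at $x=\alpha$. The singular potential term $\eta\,\delta(x-\alpha)u$ is understood through the jump condition $$\lim_{\epsilon\to0^+}\left[u_x(\alpha-\epsilon,t)-u_x(\alpha+\epsilon,t)\right]=\eta\,u(\alpha,t)\quad\text{for all } t>0,$$ together with $u_{tt}=u_{xx}$ for $x\in(-1,1)\setminus\{\alpha\}$. A steady-state solution is a time-independent solution $u(x,t)=u^s(x)$. Thus $u^s$ is continuous on $[-1,1]$, satisfies $u^s_{xx}=0$ on $(-1,\alpha)$ and on $(\alpha,1)$, satisfies $u^s(-1)=0$ and $u^s_x(1)=0$, and satisfies $\lim_{\epsilon\to0^+}[u^s_x(\alpha-\epsilon)-u^s_x(\alpha+\epsilon)]=\eta\,u^s(\alpha)$. *)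

(* Defs.v *)
From HB Require Import structures.
From mathcomp Require Import all_boot all_order all_algebra.
From mathcomp Require Import all_classical all_reals all_analysis.

Set Implicit Arguments.
Unset Strict Implicit.
Unset Printing Implicit Defensive.

Import Order.TTheory GRing.Theory Num.Theory.
Import numFieldNormedType.Exports.

Local Open Scope ring_scope.
Local Open Scope classical_set_scope.

Definition twice_derivable (R : realType) (f : R -> R) (x : R) : Prop :=
  (\forall y \near x, derivable f y 1) /\ derivable (derive1 f) x 1.

Definition has_left_derivative (R : realType) (f : R -> R) (x l : R) : Prop :=
  h^-1 * (f (x + h) - f x) @[h --> 0^'-] --> l.

(* Classical solutions u, written u x t, of
     u_tt - u_xx = eta * delta(x - alpha) * u   for -1 < x < 1, t > 0,
     u(-1, t) = 0,  u_t(1, t) + u_x(1, t) = 0   for t > 0.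
   The Dirac term is encoded by the wave equation off alpha together with the
   jump condition on u_x at alpha.  Only the values of u for x in [-1, 1] and
   t > 0 matter; accordingly u_x(1, t) is a left derivative. *)
Record delta_wave_solution (R : realType) (alpha eta : R) (u : R -> R -> R) :
  Prop := DeltaWaveSolution {
  dws_continuous : forall t : R, 0 < t -> {within `[-1, 1], continuous (u ^~ t)} ;
  dws_wave : forall x t : R, -1 < x < 1 -> x != alpha -> 0 < t ->
    [/\ twice_derivable (u x) t,
        twice_derivable (u ^~ t) x
      & derive1 (derive1 (u x)) t = derive1 (derive1 (u ^~ t)) x] ;
  dws_jump : forall t : R, 0 < t ->
    derive1 (u ^~ t) (alpha - e) - derive1 (u ^~ t) (alpha + e)
      @[e --> 0^'+] --> eta * u alpha t ;
  dws_left : forall t : R, 0 < t -> u (-1) t = 0 ;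
  dws_right : forall t : R, 0 < t ->
    derivable (u 1) t 1 /\
    exists2 ux, has_left_derivative (u ^~ t) 1 ux & derive1 (u 1) t + ux = 0
}.

Definition steady_state (R : realType) (alpha eta : R) (us : R -> R) : Prop :=
  delta_wave_solution alpha eta (fun x _ => us x).

Definition admits_nonzero_steady_state (R : realType) (alpha eta : R) : Prop :=
  exists us : R -> R,
    steady_state alpha eta us /\ exists2 x, -1 <= x <= 1 & us x != 0.

(* Main.v *)
(** A steady state is affine on each side of [alpha].  The outgoing boundary
    condition makes it constant on [[alpha, 1]], and the Dirichlet condition
    gives [a * (x + 1)] on [[-1, alpha]], so the jump condition reads
    [a = eta * a * (1 + alpha)] with [a != 0].  Conversely [min x alpha + 1]
    is a steady state for [eta = 1 / (1 + alpha)]. *)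
Require Import Defs.
From HB Require Import structures.
From mathcomp Require Import all_boot all_order all_algebra.
From mathcomp Require Import all_classical all_reals all_analysis.
From mathcomp Require Import ring lra.

Set Implicit Arguments.
Unset Strict Implicit.
Unset Printing Implicit Defensive.

Import Order.TTheory GRing.Theory Num.Theory.
Import numFieldNormedType.Exports.

Local Open Scope ring_scope.
Local Open Scope classical_set_scope.

(** The mean value theorem is used twice: on [derive1 f], which is therefore constant inside the
    interval, and then on [f] over [[p, x]]. Continuity on the closed interval carries the formula
    to [p] and [q], where [f] may fail to be differentiable. *)
Lemma affine_of_derive2_eq0 (R : realType) (f : R -> R) (p q : R) :
  p < q -> {within `[p, q], continuous f} ->
  (forall x, p < x < q -> twice_derivable f x /\ derive1 (derive1 f) x = 0) ->
  exists a : R, (forall x, p <= x <= q -> f x = f p + a * (x - p)) /\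
    (forall x, p < x < q -> derive1 f x = a).
Proof.
move=> pq fc f2.
have d1 x : p < x < q -> is_derive x (1 : R) f (derive1 f x).
  move=> /f2[[/nbhs_singleton fx _] _]; rewrite derive1E.
  exact: derivableP.
have d2 x : p < x < q -> is_derive x (1 : R) (derive1 f) 0.
  move=> /f2[[_ fx] <-]; rewrite derive1E.
  exact: derivableP.
have lt_const x y : p < x -> x < y -> y < q -> derive1 f x = derive1 f y.
  move=> px xy yq.
  have [||c _] := @MVT R (derive1 f) (fun=> 0) x y xy.
  - move=> z; rewrite in_itv/= => /andP[xz zy].
    by apply: d2; rewrite (lt_trans px)//= (lt_trans zy).
  - apply: derivable_within_continuous => w; rewrite in_itv/= => /andP[xw wy].
    have /d2 [] // : p < w < q by rewrite (lt_le_trans px)//= (le_lt_trans wy).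
  - by rewrite mul0r => /eqP; rewrite subr_eq0 => /eqP.
(* The midpoint is a reference point: the derivative there serves as the slope [a]. *)
have mid : p < (p + q) / 2 < q by apply/andP; split; lra.
have const x : p < x < q -> derive1 f x = derive1 f ((p + q) / 2).
  move=> /andP[px xq]; case/andP: mid => pm mq.
  have [xm|mx|->//] := ltgtP x ((p + q) / 2); first exact: lt_const.
  by apply/esym; exact: lt_const.
exists (derive1 f ((p + q) / 2)); split=> // x /andP[].
rewrite le_eqVlt => /predU1P[<- _|px xq]; first by rewrite subrr mulr0 addr0.
have [||c] := @MVT R f (derive1 f) p x px.
- move=> z; rewrite in_itv/= => /andP[pz zx].
  by apply: d1; rewrite pz/= (lt_le_trans zx).
- by apply: continuous_subspaceW fc; apply: subset_itvl; rewrite bnd_simp.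
- rewrite in_itv/= => /andP[pc cx] /eqP.
  by rewrite subr_eq const ?pc ?(lt_le_trans cx)// => /eqP ->; rewrite addrC.
Qed.

(** An equality valid near [x] is also valid near every point close to [x] ([near_join]), so
    [derive1 f] is known on a neighbourhood and can be differentiated again. *)
Lemma near_affine_derive (R : realType) (f : R -> R) (c d x : R) :
  (\forall y \near x, f y = c * y + d) ->
  [/\ twice_derivable f x, derive1 f x = c & derive1 (derive1 f) x = 0].
Proof.
move=> fE.
have daff (y : R) : is_derive y (1 : R) (fun z : R => c * z + d) c.
  have -> : (fun z : R => c * z + d) = c *: (id : R -> R) + cst d by [].
  apply: is_derive_eq; rewrite addr0; exact: mulr1.
have df y : (\forall z \near y, f z = c * z + d) -> is_derive y (1 : R) f c.
  move=> fyE; apply: near_eq_is_derive (daff y).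
  by apply: filterS fyE => z ->.
have f1E : \forall y \near x, derive1 f y = c.
  apply: filterS (near_join fE) => y /df fy.
  by rewrite derive1E derive_val.
have df1 : is_derive x (1 : R) (derive1 f) 0.
  apply: (@near_eq_is_derive _ _ _ (cst c)).
  by apply: filterS f1E => z ->.
split; last by rewrite derive1E derive_val.
- split; last by case: df1.
  by apply: filterS (near_join fE) => y /df [].
- exact: nbhs_singleton f1E.
Qed.

(** For [p - q < h < 0] the difference quotient at [q] is exactly [b], and limits are unique. *)
Lemma has_left_derivative_affine (R : realType) (f : R -> R) (p q b l : R) :
  p < q -> (forall x, p <= x <= q -> f x = f p + b * (x - p)) ->
  has_left_derivative f q l -> l = b.
Proof.
move=> pq fE fl; rewrite -(cvg_lim (@Rhausdorff R) fl); apply: cvg_lim => //.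
apply: cvg_near_cst; near=> h.
have h0 : h < 0 by near: h; exact: nbhs_left_lt.
have ph : p - q < h by near: h; apply: nbhs_left_gt; rewrite subr_lt0.
rewrite (fE (q + h)) ?(fE q) ?lexx ?(ltW pq)//; last by apply/andP; split; lra.
field; by rewrite lt_eqF.
Unshelve. all: by end_near. Qed.

Lemma steady_state_eta (R : realType) (alpha eta : R) :
  -1 < alpha < 1 -> admits_nonzero_steady_state alpha eta ->
  eta = 1 / (1 + alpha).
Proof.
move=> /andP[alpha_gtN1 alpha_lt1].
move=> [us [[uc uw uj ul ur] [x0 /andP[x0_ge x0_le] ux0]]].
have t1 : (0 : R) < 1 by [].
(* The time derivatives of a steady state vanish, so the wave equation at time 1 leaves a zero
   second space derivative. *)
have u2 x : -1 < x < 1 -> x != alpha ->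
    twice_derivable us x /\ derive1 (derive1 us) x = 0.
  move=> x1 xa; have [_ ? <-] := uw x 1 x1 xa t1; split=> //.
  have -> : derive1 (fun _ : R => us x) = cst 0.
    by apply/funext => t; exact: derive1_cst.
  exact: derive1_cst.
have [||a [uaE daE]] := @affine_of_derive2_eq0 R us (-1) alpha alpha_gtN1.
- by apply: continuous_subspaceW (uc 1 t1); apply: subset_itvl; rewrite bnd_simp ltW.
- by move=> x /andP[? xa]; apply: u2; rewrite ?lt_eqF//; apply/andP; split; lra.
have [||b [ubE dbE]] := @affine_of_derive2_eq0 R us alpha 1 alpha_lt1.
- by apply: continuous_subspaceW (uc 1 t1); apply: subset_itvr; rewrite bnd_simp ltW.
- by move=> x /andP[xa ?]; apply: u2; rewrite ?gt_eqF//; apply/andP; split; lra.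
(* With no time derivative, the outgoing condition says that the left derivative at 1, which is [b],
   is zero. *)
have b0 : b = 0.
  have [_ [ux /(has_left_derivative_affine alpha_lt1 ubE) ->]] := ur 1 t1.
  by rewrite [derive1 _ _]derive1_cst add0r.
have uN1 : us (-1) = 0 by exact: ul 1 t1.
(* Once [alpha - e] and [alpha + e] both lie in the interval, the difference of derivatives is
   constantly [a - b = a]. *)
have jump : a = eta * us alpha.
  rewrite -(cvg_lim (@Rhausdorff R) (uj 1 t1)); apply/esym/cvg_lim => //.
  apply: cvg_near_cst; near=> e.
  have e0 : 0 < e by near: e; exact: nbhs_right_gt.
  have ea : e < alpha + 1 by near: e; apply: nbhs_right_lt; lra.
  have e1 : e < 1 - alpha by near: e; apply: nbhs_right_lt; lra.
  rewrite daE ?dbE ?b0 ?subr0//; apply/andP; split; lra.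
have ua : us alpha = a * (1 + alpha).
  by rewrite (uaE alpha) ?uN1 ?lexx ?ltW//; ring.
(* A zero slope would make [us] vanish on the left half, hence at [alpha], hence on the right half
   where it is constant. *)
have a0 : a != 0.
  apply: contraNneq ux0 => a0.
  have [x0a|ax0] := leP x0 alpha.
    by rewrite uaE ?x0_ge// uN1 a0 mul0r addr0.
  by rewrite ubE ?(ltW ax0)// ua a0 b0 !mul0r addr0.
have al : 1 + alpha != 0 by rewrite gt_eqF//; lra.
apply: (mulIf al); rewrite divfK//; apply: (mulfI a0).
by rewrite mulr1 {2}jump ua; ring.
Unshelve. all: by end_near. Qed.

Lemma critical_eta_steady_state (R : realType) (alpha : R) :
  -1 < alpha < 1 -> admits_nonzero_steady_state alpha (1 / (1 + alpha)).
Proof.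
move=> /andP[alpha_gtN1 alpha_lt1].
pose us x : R := Num.min x alpha + 1.
have usl x : x < alpha ->
    [/\ twice_derivable us x, derive1 us x = 1 & derive1 (derive1 us) x = 0].
  move=> xa; apply: (@near_affine_derive R us 1 1).
  by apply: filterS (lt_nbhsl xa) => y ya; rewrite /us min_l ?ltW// mul1r.
have usr x : alpha < x ->
    [/\ twice_derivable us x, derive1 us x = 0 & derive1 (derive1 us) x = 0].
  move=> xa; apply: (@near_affine_derive R us 0 (alpha + 1)).
  by apply: filterS (lt_nbhsr xa) => y ya; rewrite /us min_r ?ltW// mul0r add0r.
exists us; split; last first.
  exists alpha; first by rewrite !ltW.
  by rewrite /us minxx gt_eqF//; lra.
split.
- move=> t _; apply: continuous_subspaceT => x.
  apply: cvgD; last exact: cvg_cst.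
  apply: (@continuous_min R _ id (cst alpha)) => //.
  exact: cvg_cst.
- move=> x t _ xa _.
  (* The time slice is affine in [t] with slope 0. *)
  have [|u2t _ ->] := @near_affine_derive R (fun=> us x) 0 (us x) t.
    by near=> s; rewrite mul0r add0r.
  have [us2 usE] : twice_derivable us x /\ derive1 (derive1 us) x = 0.
    by move: xa; rewrite neq_lt => /orP[/usl|/usr] [].
  by split; [exact: u2t|exact: us2|rewrite usE].
(* The slopes are 1 and 0 and [us alpha = alpha + 1], so the jump condition reads
   [1 - 0 = 1 / (1 + alpha) * (alpha + 1)]. *)
- move=> t _; apply: cvg_near_cst; near=> e.
  have e0 : 0 < e by near: e; exact: nbhs_right_gt.
  have [|_ -> _] := usl (alpha - e); first lra.
  have [|_ -> _] := usr (alpha + e); first lra.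
  rewrite /us minxx; field; rewrite gt_eqF//; lra.
- by move=> t _; rewrite /us min_l ?ltW// addNr.
- move=> t _; split; first exact: derivable_cst.
  (* For [h > alpha - 1] the point [1 + h] stays to the right of [alpha], where [us] is constant. *)
  exists 0; last by rewrite [derive1 _ _]derive1_cst addr0.
  apply: cvg_near_cst; near=> h.
  have h1 : alpha - 1 < h by near: h; apply: nbhs_left_gt; lra.
  by rewrite /us !min_r ?subrr ?mulr0//; lra.
Unshelve. all: by end_near. Qed.

Theorem lemma1 (R : realType) (alpha : R) (halpha : -1 < alpha < 1) :
  exists etac : R,
    unique (fun eta : R => 0 < eta /\ admits_nonzero_steady_state alpha eta)
      etac /\
    etac = 1 / (1 + alpha).
Proof.
exists (1 / (1 + alpha)); split=> //; split; last first.
  by move=> eta [_ /(steady_state_eta halpha)].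
split; last exact: critical_eta_steady_state.
by rewrite divr_gt0//; case/andP: halpha => ? _; lra.
Qed.
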